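(* Let $\hat D\subset\mathbb{C}^n$ be a set and let $\mathcal{X}$ be a Banach space of complex-valued functions on $\hat D$, analytic in an open set $D\subset\hat D$, that satisfies Q1–Q3 over $\hat D$. Let $\Lambda\in\mathcal{X}^*$ be such that $\Lambda(1)=1$. Then the following are equivalent: (i) $\Lambda(e^{w\cdot z})\neq0$ for every $w\in\mathbb{C}^n$. (ii) There is $b\in\hat D$ such that $\Lambda(f)=f(b)$ for every $f\in\mathcal{X}$. (iii) For every $f,g\in\mathcal{X}$ such that $fg\in\mathcal{X}$, $\Lambda(fg)=\Lambda(f)\Lambda(g)$. (iv) For every multiplier $\phi\in\mathcal{M}(\mathcal{X})$ and every $f\in\mathcal{X}$, $\Lambda(\phi f)=\Lambda(\phi)\Lambda(f)$.
   Context: $\mathcal{P}$ denotes the set of complex polynomials in $n$ variables, regarded as functions on $\hat D$. A Banach space $\mathcal{X}$ of complex-valued functions on a set $\hat D\subset\mathbb{C}^n$ satisfies Q1–Q3 over $\hat D$ if: (Q1) $\mathcal{P}$ is a dense subset of $\mathcal{X}$. (Q2) For every $z\in\hat D$ the point evaluation $\Lambda_z:\mathcal{X}\to\mathbb{C}$, $\Lambda_z f:=f(z)$, is a bounded linear functional on $\mathcal{X}$. Furthermore, if for some $z\in\mathbb{C}^n$ the map $p\mapsto p(z)$, $p\in\mathcal{P}$, extends to a bounded linear functional on all of $\mathcal{X}$, then $z\in\hat D$. (Q3) For every $1\le i\le n$ the shift operator $S_i:\mathcal{X}\to\mathcal{X}$, $(S_if)(z):=z_if(z)$, is a (well-defined)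 bounded linear operator. $e^{w\cdot z}$ denotes the function $z\mapsto \exp(\sum_{i=1}^n w_iz_i)$; under these assumptions it belongs to $\mathcal{X}$ for every $w\in\mathbb{C}^n$. $\mathcal{M}(\mathcal{X})$ is the set of multipliers of $\mathcal{X}$, i.e. functions $\phi$ on $\hat D$ with $\phi f\in\mathcal{X}$ for every $f\in\mathcal{X}$; since $1\in\mathcal{X}$, $\mathcal{M}(\mathcal{X})\subset\mathcal{X}$. $\mathcal{X}^*$ is the space of bounded linear functionals on $\mathcal{X}$. *)

(* Defs.v *)
From HB Require Import structures.
From mathcomp Require Import all_boot all_order all_algebra.
From mathcomp Require Import all_classical all_reals all_analysis.
From mathcomp Require Import complex.
(* Without notations: they clash with those of MathComp-Analysis. *)
From mathcomp Require Import (canonicals, coercions) mpoly.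

Set Implicit Arguments.
Unset Strict Implicit.
Unset Printing Implicit Defensive.

Import Order.TTheory GRing.Theory Num.Theory.
Import numFieldNormedType.Exports.

Local Open Scope classical_set_scope.
Local Open Scope ring_scope.

(* Packing R[i] as a numClosedFieldType gives it the topology and the
   normed-module structure that MathComp-Analysis puts on every numFieldType;
   as there, norms are C R-valued. *)
Definition C (R : realType) : numClosedFieldType := R[i].

Definition expC (R : realType) (z : C R) : C R :=
  Complex (expR (complex.Re z) * cos (complex.Im z))
          (expR (complex.Re z) * sin (complex.Im z)).

Definition coords (R : realType) (n : nat) (z : 'rV[C R]_n) : 'I_n -> C R :=
  fun i => z 0 i.

(* For f defined on E: near a, f is the sum of an absolutely convergent power
   series in z - a. This is meant for a interior to E. *)
Definition analytic_at (R : realType) (n : nat) (E : set 'rV[C R]_n)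
    (f : E -> C R) (a : 'rV[C R]_n) : Prop :=
  exists (r : C R) (c : mpoly.multinom n -> C R), 0 < r /\
    forall z : E, `|val z - a| < r ->
      let term m := c m * mpoly.mmap1 (coords (val z - a)) m in
      (exists M : C R, forall N : nat,
        \sum_(m : mpoly.bmultinom n N) `|term m| <= M) /\
      (fun N : nat => \sum_(m : mpoly.bmultinom n N) term m) @ \oo --> f z.

Definition bounded_op (K : numFieldType) (V W : normedModType K)
    (T : V -> W) : Prop :=
  exists M : K, forall x : V, `|T x| <= M * `|x|.

(* A Banach space of functions on E: a subspace of E -> C R with its own
   complete norm, given as the injective image of a complete normed module. *)
Record funSpace (R : realType) (n : nat) (E : set 'rV[C R]_n) := FunSpace {
  carrier :> completeNormedModType (C R);
  fval : {linear carrier -> (E -> C R)};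
  fval_inj : injective fval }.

Section FunSpaceDefs.
Context {R : realType} {n : nat} {E : set 'rV[C R]_n}.

Definition poly_fun (p : mpoly.mpoly n (C R)) : E -> C R :=
  fun z => mpoly.meval (coords (val z)) p.

Definition exp_fun (w : 'rV[C R]_n) : E -> C R :=
  fun z => expC (\sum_(i < n) w 0 i * val z 0 i).

Variable X : funSpace E.

Definition mem_space (phi : E -> C R) : Prop := exists f : X, fval X f = phi.

(* The element of X that is the function phi; 0 if phi is not in X. *)
Definition elt (phi : E -> C R) : X := xget 0 [set f : X | fval X f = phi].

Lemma fval_elt (phi : E -> C R) : mem_space phi -> fval X (elt phi) = phi.
Proof.
move=> [f fphi].
exact: (@xgetPex _ 0 [set f : X | fval X f = phi] (ex_intro _ f fphi)).
Qed.

Lemma elt_fval (f : X) : elt (fval X f) = f.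
Proof. by apply: fval_inj; apply: fval_elt; exists f. Qed.

Definition multiplier (phi : E -> C R) : Prop :=
  forall f : X, mem_space (phi \* fval X f).

Record Q1Q2Q3 : Prop := {
  poly_mem : forall p, mem_space (poly_fun p);
  poly_dense : dense [set f : X | exists p, fval X f = poly_fun p];
  eval_bounded : forall z : E, bounded_op (fun f : X => fval X f z);
  eval_domain : forall z : 'rV[C R]_n,
    (exists L : {linear X -> C R}, bounded_op L /\
       forall p, L (elt (poly_fun p)) = mpoly.meval (coords z) p) ->
    E z;
  shift_bounded : forall i : 'I_n, exists S : {linear X -> X}, bounded_op S /\
    forall (f : X) (z : E), fval X (S f) z = val z 0 i * fval X f z }.

Lemma multiplier_mem (phi : E -> C R) :
  Q1Q2Q3 -> multiplier phi -> mem_space phi.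
Proof.
move=> q mphi; have [u u1] := poly_mem q 1.
have [f fE] := mphi u; exists f; rewrite fE u1; apply/funext => z /=.
by rewrite /poly_fun mpoly.meval1 mulr1.
Qed.

End FunSpaceDefs.

(* Main.v *)
From HB Require Import structures.
Require Import Defs.
From mathcomp Require Import all_boot all_order all_algebra.
From mathcomp Require Import all_classical all_reals all_analysis.
From mathcomp Require Import complex.
From mathcomp Require Import (canonicals, coercions) mpoly.
From mathcomp Require Import zify ring.
Set Implicit Arguments.
Unset Strict Implicit.
Unset Printing Implicit Defensive.
Import Order.TTheory GRing.Theory Num.Theory.
Import numFieldNormedType.Exports.
Local Open Scope classical_set_scope.
Local Open Scope ring_scope.

(** The implication from (iii) to (iv) is immediate, since 1 is in the space
    and so multipliers are elements of it. Evaluation at a point satisfies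
    all four conditions, because an exponential never vanishes. Hence the
    content lies in recovering a point from (i) or from (iv). In both cases it
    suffices to find [b] with L(p) = p(b) for every polynomial p: boundedness
    of L on polynomials forces [b] into the domain, and density of polynomials
    extends the identity to the whole space ([eval_of_poly_eval]).

    From (iv), multiplying by the coordinate functions, which are multipliers,
    shows at once that L is evaluation at b = (L(z_1), ..., L(z_n)) on
    polynomials ([point_of_multiplicative]).

    From (i), restrict L to complex lines. For a linear form l = w.z the
    function F(t) = L(exp(t l)) = sum_k L(l^k) t^k / k! is entire, of
    exponential type, without zeros, and F(0) = 1. Such a function is
    exp(c t) ([coef_geometric]), which means that L(l^k) = L(l)^k for all k
    ([functional_powers]). Since powers of linear forms span the polynomials,
    L is evaluation at b on all of them ([eval_of_powers]).

    That a zero-free F of exponential type with F(0) = 1 is an exponential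
    is proved through its Taylor polynomials T_N, without logarithms or
    contour integrals. Write T_N(t) as the product of the factors 1 - u t, so
    that the u are the inverses of the zeros. By Newton's identities the Taylor
    coefficients would satisfy (k+1) c_{k+1} = c_1 c_k exactly if the power
    sums of the u of order at least 2 vanished ([coef_defect_le]).
    They are small: F has no zero in a given disc, hence by compactness T_N has
    none for N large ([taylor_zero_free]), so all u are small; and the growth
    of F limits the number of zeros of T_N in a disc of radius r to O(1 + r),
    uniformly in N ([jensen_count]), so that the sum of the |u|^2 tends to 0 as
    the zero-free disc grows ([sum_sqr_le]). *)

(** * Zeros and coefficients of a product of linear factors *)

Section Polynomials.
Variable K : numClosedFieldType.
Implicit Types (p q : {poly K}) (s : seq K).

(** The mean of q over t and -t is the even part of q at t^2, a polynomial of
    half the degree with the same value at 0; so one can descend on the degree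
    by taking square roots, and no circle mean is needed. *)
Lemma maximum_principle_center q (r : K) :
  0 <= r -> exists2 t, `|t| = r & `|q.[0]| <= `|q.[t]|.
Proof.
elim: {q}(size q).+1 {-2}q (ltnSn (size q)) r => // m IHm q q_le r r0.
have [q_const|q_big] := leqP (size q) 1.
  exists r; first by rewrite ger0_norm.
  by rewrite (size1_polyC q_const) !hornerC.
have [|s s_r2 q0_le] := IHm (even_poly q) _ (r ^+ 2) (exprn_ge0 _ r0).
  apply: leq_ltn_trans (size_even_poly q) _.
  by move: q_le q_big; case: (size q) => [|[|k]] //; rewrite !ltnS => + _; lia.
pose t := sqrtC s.
have tE : `|t| = r.
  by apply/eqP; rewrite -(@eqrXn2 _ 2) // -normrX sqrtCK s_r2.
have evenE x : q.[x] = (even_poly q).[x ^+ 2] + (odd_poly q).[x ^+ 2] * x.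
  by rewrite -{1}[q]poly_even_odd hornerD hornerM !horner_comp !hornerXn hornerX.
have q0E : q.[0] = (even_poly q).[0] by rewrite evenE mulr0 addr0 expr0n.
have midE : (even_poly q).[s] *+ 2 = q.[t] + q.[- t].
  rewrite !evenE sqrrN sqrtCK; ring.
have : `|q.[0]| *+ 2 <= `|q.[t]| + `|q.[- t]|.
  by apply: le_trans (ler_normD _ _); rewrite -midE normrMn lerMn2r q0E q0_le orbT.
have [q_t|t_q] := real_leP (normr_real q.[0]) (normr_real q.[t]).
  by exists t.
move=> two_le; exists (- t); first by rewrite normrN.
by rewrite -(lerD2l `|q.[0]|) -mulr2n (le_trans two_le) // lerD2r ltW.
Qed.

Lemma horner0_prod_1MX s : (\prod_(u <- s) (1 - u *: 'X)).[0] = 1 :> K.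
Proof.
rewrite horner_prod big1 // => u _.
by rewrite hornerD hornerN hornerZ hornerX mulr0 hornerC subr0.
Qed.

(** A Jensen inequality. On the circle of radius 3r each factor 1 - u t with
    |u| r >= 1 has modulus at least 2, while the product of the other factors
    is 1 at the centre and so reaches modulus 1 somewhere on that circle. *)
Lemma jensen_count s (r B : K) : 0 < r ->
  (forall t, `|t| = 3 * r -> `|(\prod_(u <- s) (1 - u *: 'X)).[t]| <= B) ->
  2 ^+ count (fun u : K => 1 <= `|u| * r) s <= B.
Proof.
move=> r0 p_le; set big := fun u => _.
have [|t t_3r q_ge1] := @maximum_principle_center
  (\prod_(u <- s | ~~ big u) (1 - u *: 'X)) (3 * r).
  by rewrite mulr_ge0 ?ltW.
rewrite -big_filter horner0_prod_1MX normr1 big_filter in q_ge1.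
apply: le_trans (p_le t t_3r).
rewrite (bigID big) /= hornerM normrM.
apply: (@le_trans _ _ `|(\prod_(u <- s | big u) (1 - u *: 'X)).[t]|); last first.
  by rewrite ler_peMr.
rewrite horner_prod normr_prod -iter_mulr_1 -big_const_seq.
apply: ler_prod => u big_u; rewrite ler0n /=.
rewrite hornerD hornerN hornerZ hornerX hornerC.
have : 3 <= `|u * t|.
  rewrite normrM t_3r mulrCA -[leLHS]mulr1 ler_pM2l //.
have := lerB_dist (u * t) 1; rewrite normr1 distrC => le3 le1.
by apply: le_trans le3; rewrite lerBrDr -(natrD _ 2 1).
Qed.

Lemma sum_half_powers (i k : nat) :
  \sum_(i.+1 <= j < (i + k).+1) 2 ^- j = 2 ^- i - 2 ^- (i + k) :> K.
Proof.
elim: k => [|k IHk]; first by rewrite addn0 big_geq ?subrr.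
rewrite addnS big_nat_recr /= ?IHk; last by lia.
rewrite exprS invfM.
by set x := _ ^- (i + k); field; rewrite expf_neq0 // pnatr_eq0.
Qed.

(** If at most a + b r of the points 1/u lie in the disc of radius r and none
    in the disc of radius 2^i, the sum of the |u|^2 is O(2^-i): the points at
    distance about 2^j contribute O(2^j) terms of size 4^-j. The number
    [k] serves to make the dyadic summation finite. *)
Lemma sum_sqr_le s (i k a b : nat) :
  {in s, forall u : K, `|u| * 2 ^+ i < 1} ->
  {in s, forall u : K, 1 <= `|u| * 2 ^+ (i + k)} ->
  (forall j, count (fun u : K => 1 <= `|u| * 2 ^+ j)%R s <= a + b * 2 ^ j)%N ->
  \sum_(u <- s) `|u| ^+ 2 <= 4 * (a + b)%:R * 2 ^- i.
Proof.
move=> s_lt s_ge s_count.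
have dyadic u : u \in s -> `|u| ^+ 2 <=
    \sum_(i.+1 <= j < (i + k).+1) 4 * 4 ^- j *+ (1 <= `|u| * 2 ^+ j)%R.
  move=> us.
  have term_ge0 j : 0 <= 4 * 4 ^- j *+ (1 <= `|u| * 2 ^+ j)%R :> K.
    by apply: mulrn_wge0; rewrite mulr_ge0 // invr_ge0 exprn_ge0.
  (* The least j with |u| 2^j >= 1 names the one dyadic shell that is kept. *)
  pose P j := 1 <= `|u| * 2 ^+ j.
  have exP : exists j, P j by exists (i + k)%N; apply: s_ge.
  have := ex_minnP exP; case=> -[|j] Pj minj.
    move: Pj (s_lt u us); rewrite /P expr0 mulr1 => u1 /lt_geF/negP[].
    have le12 : 1 <= 2 ^+ i :> K by rewrite exprn_ege1 // ler1n.
    by have := ler_pM ler01 ler01 u1 le12; rewrite mulr1.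
  have j_ge : (i <= j)%N.
    rewrite leqNgt; apply/negP => j_lt; have /lt_geF := s_lt u us => /negP[].
    rewrite (le_trans Pj) // ler_wpM2l // ler_weXn2l ?ler1n //.
  have j_le : (j < i + k)%N by apply: minj; apply: s_ge.
  rewrite (bigD1_seq j.+1) ?iota_uniq ?mem_index_iota ?ltnS ?j_ge //=.
  rewrite -/(P j.+1) Pj mulr1n.
  rewrite -[leLHS]addr0 lerD //; last by apply: sumr_ge0.
  have Nj : `|u| * 2 ^+ j < 1.
    rewrite real_ltNge ?realM ?realX ?realn ?normr_real //.
    by apply/negP => /minj; rewrite ltnn.
  rewrite (exprS 4) invfM mulrA divff ?pnatr_eq0 // mul1r.
  rewrite -[leRHS]mul1r ler_pdivlMr ?exprn_gt0 //.
  have -> : 4 ^+ j = (2 ^+ j) ^+ 2 :> K by rewrite -exprM mulnC exprM -(natrX _ 2 2).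
  by rewrite -exprMn exprn_ile1 ?mulr_ge0 ?exprn_ge0 // ltW.
have dyadic_sum l : \sum_(u <- s) 4 * 4 ^- l *+ (1 <= `|u| * 2 ^+ l)%R <=
    4 * (a + b)%:R * 2 ^- l :> K.
  rewrite sumrMnr -big_mkcond /= sum1_count.
  have count_le : (count (fun u : K => 1 <= `|u| * 2 ^+ l)%R s <= (a + b) * 2 ^ l)%N.
    apply: leq_trans (s_count l) _.
    by rewrite mulnDl leq_add2r leq_pmulr ?expn_gt0.
  have -> : 4 ^- l = 2 ^- l * 2 ^- l :> K.
    by rewrite -invfM -exprMn -natrM.
  set c := count _ _ in count_le *.
  have c_le : 2 ^- l * c%:R <= (a + b)%:R :> K.
    by rewrite ler_pdivrMl ?exprn_gt0 // -natrX -natrM mulnC ler_nat.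
  rewrite -(mulr_natr _ c) -!mulrA ler_pM2l //.
  rewrite mulrC [leRHS]mulrC -!mulrA.
  by rewrite ler_pM2l ?invr_gt0 ?exprn_gt0 // mulrC.
rewrite big_seq; apply: le_trans (ler_sum _ dyadic) _.
rewrite -big_seq exchange_big /=.
apply: le_trans (ler_sum _ (fun j _ => dyadic_sum j)) _.
rewrite -mulr_sumr ler_wpM2l ?mulr_ge0 ?ler0n // sum_half_powers.
by rewrite gerBl invr_ge0 exprn_ge0.
Qed.

(** Factors 1 - u X rather than X - z keep the constant coefficient visible and
    make the power sums of Newton's identities those of the inverse roots. *)
Lemma split_at_inverse_roots p : p.[0] = 1 ->
  exists2 s, p = \prod_(u <- s) (1 - u *: 'X)
           & {in s, forall u, u != 0 /\ root p u^-1}.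
Proof.
move=> p0; have [r pE] := closed_field_poly_normal p.
have p_neq0 : p != 0 by apply: contra_eq_neq p0 => ->; rewrite horner0 eq_sym oner_eq0.
have lead_neq0 : lead_coef p != 0 by rewrite lead_coef_eq0.
have root_r z : z \in r -> root p z.
  by move=> zr; rewrite pE rootZ // root_prod_XsubC.
have r_neq0 z : z \in r -> z != 0.
  by move=> /root_r; apply: contraTneq => ->; rewrite /root p0 oner_eq0.
exists (map GRing.inv r); last first.
  move=> u /mapP[z zr ->]; rewrite invr_eq0 invrK; split; [exact: r_neq0|exact: root_r].
rewrite big_map {1}pE.
have -> : \prod_(z <- r) ('X - z%:P) =
    (\prod_(z <- r) - z) *: \prod_(z <- r) (1 - z^-1 *: 'X) :> {poly K}.
  rewrite -scaler_prod !big_seq; apply: eq_bigr => z /r_neq0 z0.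
  by rewrite scalerBr scalerA mulNr divff // scaleN1r opprK addrC scaleNr alg_polyC.
have : lead_coef p * (\prod_(z <- r) - z) = 1.
  rewrite -[RHS]p0 [in RHS]pE hornerZ horner_prod; congr (_ * _).
  by apply: eq_bigr => z _; rewrite hornerXsubC sub0r.
by rewrite scalerA => ->; rewrite scale1r.
Qed.

(** Logarithmic differentiation: p' / p is the sum of the - u / (1 - u X), and
    u / (1 - u X) is the geometric series of the u^(j+1) X^j. Truncating the
    series at order m costs a multiple of X^m. *)
Lemma newton_identity_mod s (m : nat) (p := \prod_(u <- s) (1 - u *: 'X)) :
  exists q, p^`() + p * (\sum_(u <- s) \poly_(j < m) u ^+ j.+1) = 'X^m * q.
Proof.
rewrite {}/p; elim: s => [|u s [q qE]].
  by exists 0; rewrite !big_nil derivC mulr0 mulr0 addr0.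
rewrite !big_cons; set p := \prod_(j <- s) _ in qE *; set G := \sum_(j <- s) _ in qE *.
have geom : (1 - u *: 'X) * (\poly_(j < m) u ^+ j.+1) = u%:P - u ^+ m.+1 *: 'X^m.
  have -> : \poly_(j < m) u ^+ j.+1 = u *: \sum_(j < m) (u *: 'X) ^+ j.
    rewrite poly_def scaler_sumr; apply: eq_bigr => j _.
    by rewrite exprZn scalerA exprS.
  rewrite -scalerAr -opprB mulNr -subrX1 opprB.
  by rewrite exprZn scalerBr scalerA exprS alg_polyC.
exists ((1 - u *: 'X) * q - u ^+ m.+1 *: p).
rewrite derivM.
have -> : (1 - u *: 'X)^`() = - u%:P :> {poly K}.
  by rewrite derivB derivZ derivX derivC sub0r alg_polyC.
set a := 1 - u *: 'X in geom *; set g := \poly_(j < m) _ in geom *.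
have -> : - u%:P * p + a * p^`() + a * p * (g + G) =
    a * (p^`() + p * G) + p * (a * g - u%:P) by ring.
rewrite qE geom -!mul_polyC; ring.
Qed.

Lemma newton_identity s (k : nat) (p := \prod_(u <- s) (1 - u *: 'X)) :
  p`_k.+1 *+ k.+1 = - \sum_(j < k.+1) p`_j * \sum_(u <- s) u ^+ (k - j).+1.
Proof.
have [q /(congr1 (coefp k))] := newton_identity_mod s k.+1.
rewrite /coefp -/p coefD coef_deriv coefXnM ltnSn coefM => /eqP.
rewrite addr_eq0 => /eqP ->; congr (- _); apply: eq_bigr => j _; congr (_ * _).
rewrite coef_sum; apply: eq_bigr => u _; rewrite coef_poly.
by rewrite ltnS leq_subr.
Qed.

(** In Newton's identity the summand of order 1 is c_1 c_k; what remains are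
    the power sums of order at least 2, each bounded by the sum of the |u|^2
    because |u| <= 1. *)
Lemma coef_defect_le s (k : nat) (e : K) (p := \prod_(u <- s) (1 - u *: 'X)) :
  {in s, forall u, `|u| <= 1} -> \sum_(u <- s) `|u| ^+ 2 <= e ->
  `|p`_k.+1 *+ k.+1 - p`_1 * p`_k| <= e * \sum_(j < k) `|p`_j|.
Proof.
move=> s_le1 s_le.
have p1E : p`_1 = - \sum_(u <- s) u.
  rewrite -[p`_1]mulr1n newton_identity big_ord1 -/p -horner_coef0 horner0_prod_1MX.
  by rewrite mul1r.
rewrite newton_identity big_ord_recr /= -/p subnn p1E mulNr opprK.
under [\sum_(u <- s) u ^+ 1]eq_bigr do rewrite expr1.
rewrite opprD mulrC subrK normrN mulr_sumr.
apply: le_trans (ler_norm_sum _ _ _) (ler_sum _ _) => j _.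
rewrite normrM mulrC ler_wpM2r //.
apply: le_trans (ler_norm_sum _ _ _) (le_trans _ s_le).
rewrite !big_seq; apply: ler_sum => u us; rewrite normrX.
by apply: ler_wiXn2l; rewrite ?s_le1 // ltnS subn_gt0.
Qed.
End Polynomials.

(** * Real bounds on complex numbers, and compactness of discs *)

Section ComplexNorms.
Variable R : realType.
Implicit Types (z t : C R) (x y : R).

(** The norm of [C R] takes values in [C R]; [cplx] and [nrm] carry estimates to
    the ordered field R, where exponentials and limits are available. *)
Definition cplx x : C R := Complex x 0.
Arguments cplx : simpl never.

Fact cplx_is_zmod_morphism : zmod_morphism cplx.
Proof. exact: (rmorphB (real_complex R)). Qed.

Fact cplx_is_monoid_morphism : monoid_morphism cplx.
Proof. split; [exact: (rmorph1 (real_complex R))|exact: (rmorphM (real_complex R))]. Qed.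

HB.instance Definition _ := GRing.isZmodMorphism.Build R (C R) cplx cplx_is_zmod_morphism.
HB.instance Definition _ := GRing.isMonoidMorphism.Build R (C R) cplx
  cplx_is_monoid_morphism.

Lemma ler_cplx x y : (cplx x <= cplx y) = (x <= y).
Proof. exact: lecR. Qed.

Lemma ltr_cplx x y : (cplx x < cplx y) = (x < y).
Proof. exact: ltcR. Qed.

Definition nrm z : R := complex.Re `|z|.

Lemma cplx_nrm z : cplx (nrm z) = `|z|.
Proof. by rewrite /nrm [`|z|]normc_def. Qed.

Lemma cplx_inj : injective cplx.
Proof. by move=> x y []. Qed.

Lemma cplx_ge0 x : (0 <= cplx x) = (0 <= x).
Proof. by rewrite -(ler_cplx 0) rmorph0. Qed.

Lemma nrm_ge0 z : 0 <= nrm z.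
Proof. by rewrite -cplx_ge0 cplx_nrm. Qed.

Lemma norm_cplx x : `|cplx x| = cplx `|x|.
Proof.
have [x0|x0] := ger0P x; first by rewrite ger0_norm ?cplx_ge0.
by rewrite ler0_norm ?rmorphN // -(rmorph0 cplx) ler_cplx ltW.
Qed.

Lemma cplx_gt0P (e : C R) : 0 < e -> exists2 x, 0 < x & e = cplx x.
Proof.
move=> e0; exists (nrm e); last by rewrite cplx_nrm gtr0_norm.
by rewrite -ltr_cplx cplx_nrm rmorph0 normr_gt0 gt_eqF.
Qed.

Definition imu : C R := Complex 0 1.

Lemma imu_sqr : imu ^+ 2 = -1. Proof. exact: sqr_i. Qed.

Lemma Complex_split x y : Complex x y = cplx x + imu * cplx y :> C R.
Proof. exact: (complexE (Complex x y)). Qed.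

Lemma norm_imu : `|imu| = 1.
Proof. by apply/eqP; rewrite -(@eqrXn2 _ 2) // -normrX imu_sqr normrN1 expr1n. Qed.

Lemma Complex_norm_le x y : `|Complex x y : C R| <= cplx (`|x| + `|y|).
Proof.
rewrite Complex_split rmorphD /= -!norm_cplx (le_trans (ler_normD _ _)) //.
by rewrite normrM norm_imu mul1r.
Qed.

Lemma Re_le_norm z : `|complex.Re z| <= nrm z.
Proof. rewrite -ler_cplx cplx_nrm; exact: normc_ge_Re. Qed.

Lemma Im_le_norm z : `|complex.Im z| <= nrm z.
Proof.
have -> : nrm z = nrm (imu * z).
  by apply: cplx_inj; rewrite !cplx_nrm normrM norm_imu mul1r.
apply: le_trans (Re_le_norm _).
by case: z => x y /=; rewrite mul0r mul1r sub0r normrN.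
Qed.

(** A sequence of polynomials that is eventually zero-free near each point is
    eventually zero-free on each disc, by compactness of the square around the
    disc. *)
Lemma zero_free_eventually (p : nat -> {poly C R}) (r : R) :
  (forall t, exists2 d : R, 0 < d & exists N0, forall N s, (N0 <= N)%N ->
     `|s - t| < cplx d -> ~~ root (p N) s) ->
  exists N0, forall N t, (N0 <= N)%N -> `|t| <= cplx r -> ~~ root (p N) t.
Proof.
move=> locally.
have /compact_near_coveringP cov : compact (`[- r, r] `*` `[- r, r] : set (R * R)).
  by apply: compact_setX; apply: segment_compact.
have := cov nat \oo (fun N xy => ~~ root (p N) (Complex xy.1 xy.2 : C R)) _ _.
case=> [[x y] /= _|N0 _ zfree].
  have [d d0 [N0 N0P]] := locally (Complex x y : C R).
  exists (ball (x, y) (d / 2), [set N | (N0 <= N)%N]).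
    by split=> /=; [apply: nbhsx_ballx; rewrite divr_gt0|exists N0].
  move=> [[x' y'] N] /= [[/= xx' yy'] N0N].
  apply: (N0P N (Complex x' y' : C R)) => //.
  have -> : (Complex x' y' : C R) - Complex x y = Complex (x' - x) (y' - y) by [].
  apply: le_lt_trans (Complex_norm_le _ _) _; rewrite ltr_cplx.
  rewrite [ltRHS]splitr ltrD // distrC //.
exists N0 => N t N0N t_r.
have := zfree N N0N (complex.Re t, complex.Im t); case: t t_r => x y t_r /=; apply.
have t_r' : nrm (Complex x y) <= r by rewrite -ler_cplx cplx_nrm.
split; rewrite /= in_itv /= -ler_norml.
  by apply: le_trans (Re_le_norm _) t_r'.
by apply: le_trans (Im_le_norm _) t_r'.
Qed.
End ComplexNorms.

(** * Partial sums of the exponential series *)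

Section ExpSums.
Variable K : numFieldType.
Implicit Types a b : K.

Definition exp_sum (N : nat) a : K := \sum_(k < N) a ^+ k / k`!%:R.

Lemma exp_sumD N a b :
  exp_sum N (a + b) = \sum_(i < N) a ^+ i / i`!%:R * exp_sum (N - i) b.
Proof.
elim: N => [|N IHN]; first by rewrite /exp_sum !big_ord0.
have exp_sumS k c : exp_sum k.+1 c = exp_sum k c + c ^+ k / k`!%:R.
  by rewrite /exp_sum big_ord_recr.
under eq_bigr => i _ do rewrite (subSn (ltn_ord i : (i <= N)%N)) exp_sumS mulrDr.
rewrite exp_sumS IHN big_split /= big_ord_recr /= subnn [exp_sum 0 b]big_ord0.
rewrite mulr0 addr0; congr (_ + _).
rewrite addrC exprDn mulr_suml; apply: eq_bigr => i _.
have iN : (i <= N)%N by rewrite -ltnS.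
have fact0 (m : nat) : m`!%:R != 0 :> K by rewrite pnatr_eq0 -lt0n fact_gt0.
rewrite -(bin_fact iN) !natrM -(mulr_natl _ 'C(N, i)).
by field; rewrite !fact0 pnatr_eq0 -lt0n bin_gt0 iN.
Qed.

Lemma exp_sum_defect N a b : exp_sum N a * exp_sum N b - exp_sum N (a + b) =
  \sum_(i < N) \sum_(N - i <= j < N) a ^+ i / i`!%:R * (b ^+ j / j`!%:R).
Proof.
rewrite exp_sumD {1}/exp_sum mulr_suml -sumrB; apply: eq_bigr => i _.
rewrite -mulrBr -mulr_sumr; congr (_ * _).
rewrite /exp_sum -!(big_mkord xpredT (fun j => b ^+ j / j`!%:R)).
by rewrite (@big_cat_nat _ _ _ (N - i)) ?leq_subr //= addrAC subrr add0r.
Qed.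

(** The defect of additivity is a polynomial in a and b with nonnegative
    coefficients, so its value at (|a|, |b|) dominates; there the limit is known
    from the real exponential. *)
Lemma exp_sum_defect_le N a b :
  `|exp_sum N a * exp_sum N b - exp_sum N (a + b)| <=
  exp_sum N `|a| * exp_sum N `|b| - exp_sum N (`|a| + `|b|).
Proof.
rewrite !exp_sum_defect.
apply: le_trans (ler_norm_sum _ _ _) (ler_sum _ _) => i _.
apply: le_trans (ler_norm_sum _ _ _) (ler_sum _ _) => j _.
by rewrite !normrM !normfV !normrX !normr_nat.
Qed.
End ExpSums.

Section RealEstimates.
Variable R : realType.

Lemma exists_le_pow2 (x : R) : exists k : nat, x <= 2 ^+ k.
Proof.
exists (Num.bound `|x|); apply: le_trans (ler_norm x) _.
apply: le_trans (ltW (archi_boundP (normr_ge0 x))) _.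
by rewrite -natrX ler_nat ltnW // ltn_expl.
Qed.

Lemma le0_of_le_pow2 (x B : R) : (forall i, x <= B * 2 ^- i) -> x <= 0.
Proof.
move=> x_le; rewrite leNgt; apply/negP => x0.
have [m] := exists_le_pow2 ((B + 1) / x); rewrite ler_pdivrMr // => le_m.
have := x_le m; rewrite ler_pdivlMr ?exprn_gt0 // mulrC => /(le_trans le_m).
by rewrite gerDl ler10.
Qed.

Lemma exp_sum_le_expR (x : R) N : 0 <= x -> exp_sum N x <= expR x.
Proof.
move=> x0; rewrite /exp_sum -(big_mkord xpredT (fun k => x ^+ k / k`!%:R)).
apply: (@nondecreasing_cvgn_le R (series (exp_coeff x))).
  by apply: nondecreasing_series => k _ _; exact: exp_coeff_ge0.
exact: is_cvg_series_exp_coeff.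
Qed.
End RealEstimates.

(** * Zero-free entire functions of exponential type *)

(** The entire function is represented by the sequence [c] of its Taylor
    coefficients, and its values only occur as limits of [taylor]. *)
Section Entire.
Variables (R : realType) (c : nat -> C R) (M A : R).
Hypothesis c0 : c 0%N = 1.
Hypotheses (M_ge0 : 0 <= M) (A_ge0 : 0 <= A).
Hypothesis c_le : forall k, `|c k| <= cplx (M * (A ^+ k / k`!%:R)).

Definition taylor N : {poly C R} := \poly_(k < N) c k.

Lemma taylor_series_le N (e : nat -> C R) (r : R) : 0 <= r ->
  (forall k, `|e k| <= cplx (r ^+ k)) ->
  `|\sum_(k < N) c k * e k| <= cplx (M * expR (A * r)).
Proof.
move=> r_ge0 e_le.
apply: le_trans (ler_norm_sum _ _ _) _.
apply: (@le_trans _ _ (cplx (M * exp_sum N (A * r)))); last first.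
  by rewrite ler_cplx ler_wpM2l // exp_sum_le_expR // mulr_ge0.
rewrite mulr_sumr rmorph_sum; apply: ler_sum => k _ /=; rewrite normrM.
have -> : M * ((A * r) ^+ k / k`!%:R) = M * (A ^+ k / k`!%:R) * r ^+ k.
  by rewrite exprMn; ring.
by rewrite rmorphM ler_pM.
Qed.

Lemma taylor_le N t : `|(taylor N).[t]| <= cplx (M * expR (A * nrm t)).
Proof.
rewrite horner_poly taylor_series_le ?nrm_ge0 // => k.
by rewrite rmorphXn /= cplx_nrm normrX.
Qed.

Lemma normB_exp_le (s t r : C R) k : 1 <= r -> `|s| <= r -> `|t| <= r ->
  `|s ^+ k - t ^+ k| <= `|s - t| * (2 * r) ^+ k.
Proof.
move=> r1 s_r t_r; have r0 := le_trans ler01 r1.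
rewrite subrXX normrM ler_wpM2l //.
apply: le_trans (ler_norm_sum _ _ _) _.
apply: (@le_trans _ _ (\sum_(i < k) r ^+ k)).
  apply: ler_sum => i _; rewrite normrM !normrX.
  apply: (@le_trans _ _ (r ^+ (k.-1 - i) * r ^+ i)).
    by rewrite ler_pM ?exprn_ge0 // lerXn2r ?nnegrE.
  by rewrite -exprD ler_weXn2l //; have := ltn_ord i; lia.
rewrite sumr_const card_ord exprMn -(mulr_natl _ k) ler_wpM2r ?exprn_ge0 //.
by rewrite -natrX ler_nat ltnW // ltn_expl.
Qed.

(** Uniformity in N is the point: it turns a lower bound at one point into a
    zero-free neighbourhood that serves all large N. The crude factor 2 r comes
    from k <= 2^k and keeps the bound in exponential form. *)
Lemma taylor_lipschitz N s t r : 1 <= r -> `|s| <= cplx r -> `|t| <= cplx r ->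
  `|(taylor N).[s] - (taylor N).[t]| <= `|s - t| * cplx (M * expR (A * (2 * r))).
Proof.
move=> r1 s_r t_r; have [->|st] := eqVneq s t.
  by rewrite !subrr normr0 mul0r.
rewrite mulrC -ler_pdivrMr ?normr_gt0 ?subr_eq0 // -normf_div.
rewrite !horner_poly -sumrB mulr_suml.
under eq_bigr do rewrite -mulrBr -mulrA.
apply: (taylor_series_le N (e := fun k => (s ^+ k - t ^+ k) / (s - t))) => [|k].
  by rewrite mulr_ge0 // (le_trans ler01).
rewrite normf_div ler_pdivrMr ?normr_gt0 ?subr_eq0 // mulrC.
rewrite rmorphXn rmorphM rmorphMn rmorph1 /=; apply: normB_exp_le => //.
by rewrite -(rmorph1 (@cplx R)) ler_cplx.
Qed.

(** The values of the entire function are nonzero, said of partial sums. *)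
Hypothesis nonvanishing : forall t, exists2 d : R, 0 < d &
  exists N0, forall N, (N0 <= N)%N -> cplx d <= `|(taylor N).[t]|.

Lemma taylor_zero_free (r : R) :
  exists N0, forall N t, (N0 <= N)%N -> `|t| <= cplx r -> ~~ root (taylor N) t.
Proof.
apply: zero_free_eventually => t; have [d d0 [N0 dN0]] := nonvanishing t.
pose q := nrm t + 1; pose B := M * expR (A * (2 * q)).
have q1 : 1 <= q by rewrite lerDr nrm_ge0.
have B0 : 0 <= B by rewrite mulr_ge0 ?expR_ge0.
exists (Num.min 1 (d / (B + 1))).
  by rewrite lt_min ltr01 divr_gt0 // ltr_wpDl.
exists N0 => N s N0N; rewrite -cplx_nrm ltr_cplx lt_min => /andP[st1 std].
apply/negP => /rootP sroot.
have t_q : `|t| <= cplx q by rewrite -cplx_nrm ler_cplx lerDl.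
have s_q : `|s| <= cplx q.
  rewrite -[s](subrK t) (le_trans (ler_normD _ _)) // -!cplx_nrm -rmorphD.
  by rewrite ler_cplx addrC lerD2l ltW.
have := le_trans (dN0 N N0N) (_ : _ <= `|s - t| * cplx B).
rewrite -[(taylor N).[t]]subr0 -sroot distrC => /(_ (taylor_lipschitz _ q1 s_q t_q)).
rewrite -cplx_nrm -rmorphM ler_cplx => d_le.
move: std; rewrite ltr_pdivlMr ?ltr_wpDl // => /lt_le_trans/(_ d_le).
by rewrite mulrDr mulr1 -subr_gt0 opprD addrA subrr sub0r oppr_gt0 ltNge nrm_ge0.
Qed.

Lemma pow2E (j : nat) : 2 ^+ j = cplx (2 ^+ j) :> C R.
Proof. by rewrite rmorphXn rmorph_nat. Qed.

Lemma exists_uniform_pow2 (s : seq (C R)) i : {in s, forall u, u != 0} ->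
  exists k, {in s, forall u : C R, 1 <= `|u| * 2 ^+ (i + k)}.
Proof.
elim: s => [|u s IHs] s0; first by exists 0%N.
have [|k kP] := IHs; first by move=> v vs; rewrite s0 // in_cons vs orbT.
have u0 : 0 < nrm u by rewrite -ltr_cplx cplx_nrm rmorph0 normr_gt0 s0 ?mem_head.
have [l] := exists_le_pow2 (nrm u)^-1; rewrite -[X in X <= _]mul1r ler_pdivrMr // => lP.
have pow_mono (m n : nat) (x : C R) : (m <= n)%N -> `|x| * 2 ^+ m <= `|x| * 2 ^+ n.
  by move=> mn; rewrite ler_wpM2l // ler_weXn2l ?ler1n.
exists (k + l)%N => v; rewrite in_cons => /predU1P[->|/kP v_ge].
  apply: le_trans (pow_mono l _ _ _); last by lia.
  by rewrite -cplx_nrm pow2E -rmorphM -(rmorph1 (@cplx R)) ler_cplx mulrC.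
by apply: le_trans v_ge (pow_mono _ _ _ _); lia.
Qed.

(** The coefficient form of F' = c_1 F, that is F(t) = exp(c_1 t). The defect
    is at most a constant times 2^-i as soon as the Taylor polynomial is
    zero-free on the disc of radius 2^i, and i is arbitrary. *)
Lemma coef_geometric k : c k.+1 *+ k.+1 = c 1%N * c k.
Proof.
have [a Ma] := exists_le_pow2 M; have [b expb] := exists_le_pow2 (expR (A * 3)).
apply/eqP; rewrite -subr_eq0 -normr_le0 -cplx_nrm -(rmorph0 (@cplx R)) ler_cplx.
pose B := 4 * (a + b)%:R * \sum_(j < k) nrm (c j).
apply: (@le0_of_le_pow2 _ _ B) => i.
have [N0 zero_free] := taylor_zero_free (2 ^+ i).
pose N := maxn N0 k.+2.
have taylorE j : (j <= k.+1)%N -> (taylor N)`_j = c j.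
  by move=> jk; rewrite coef_poly ifT //; rewrite /N; lia.
have [|s tE s_root] := @split_at_inverse_roots _ (taylor N).
  by rewrite horner_coef0 taylorE.
have s_lt u : u \in s -> `|u| * 2 ^+ i < 1.
  move=> /s_root[u0 ru]; rewrite real_ltNge ?realM ?normr_real ?realX ?realn //.
  apply/negP => u_ge; have := zero_free N u^-1 (leq_maxl _ _).
  rewrite ru normfV -pow2E -[X in X <= _ -> _]mul1r ler_pdivrMr ?normr_gt0 // mulrC.
  by move=> /(_ u_ge).
have [l s_ge] : exists k, {in s, forall u : C R, 1 <= `|u| * 2 ^+ (i + k)}.
  by apply: exists_uniform_pow2 => u /s_root[].
have s_count j : (count (fun u : C R => 1 <= `|u| * 2 ^+ j)%R s <= a + b * 2 ^ j)%N.
  rewrite -(@leq_exp2l 2) // -(ler_nat (C R)) natrX.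
  apply: le_trans (jensen_count (B := cplx (M * expR (A * (3 * 2 ^+ j)))) _ _) _.
  - by rewrite exprn_gt0.
  - move=> t t_eq; rewrite -tE; apply: le_trans (taylor_le _ _) _.
    rewrite ler_cplx ler_wpM2l // ler_expR ler_wpM2l //.
    by rewrite -ler_cplx cplx_nrm t_eq rmorphM rmorph_nat pow2E.
  rewrite natrX pow2E ler_cplx exprD ler_pM ?expR_ge0 //.
  by rewrite mulrA -natrX expRM_natr exprM lerXn2r ?nnegrE ?expR_ge0 ?exprn_ge0.
have s_sqr := sum_sqr_le s_lt s_ge s_count.
have s_le1 : {in s, forall u : C R, `|u| <= 1}.
  move=> u us; apply: le_trans (ltW (s_lt u us)).
  by rewrite ler_peMr // exprn_ege1 // ler1n.
have := coef_defect_le k s_le1 s_sqr; rewrite -tE !taylorE // => le.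
rewrite -ler_cplx cplx_nrm; apply: le_trans le _.
rewrite /B !rmorphM !rmorph_nat rmorph_sum fmorphV rmorphXn rmorph_nat mulrAC.
rewrite le_eqVlt; apply/orP; left; apply/eqP; congr (_ * _ * _).
apply: eq_bigr => j _; rewrite taylorE ?cplx_nrm //.
by have := ltn_ord j; lia.
Qed.
End Entire.

(** * The complex exponential as a sum of its series *)

Section ExpC.
Variable R : realType.
Implicit Types (x y : R) (z : C R).

Lemma cvg_Complex (u v : nat -> R) x y : u @ \oo --> x -> v @ \oo --> y ->
  (fun N => Complex (u N) (v N) : C R) @ \oo --> (Complex x y : C R).
Proof.
move=> ux vy; apply/cvgrPdist_lt => _ /cplx_gt0P[e e0 ->].
have e2 : 0 < e / 2 by rewrite divr_gt0.
near=> N; apply: le_lt_trans (Complex_norm_le (x - u N) (y - v N)) _.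
rewrite ltr_cplx [ltRHS]splitr ltrD //; near: N.
  by move/cvgrPdist_lt : ux; apply.
by move/cvgrPdist_lt : vy; apply.
Unshelve. all: by end_near. Qed.

Lemma cvg_cplx (u : nat -> R) x : u @ \oo --> x -> (fun N => cplx (u N)) @ \oo --> cplx x.
Proof. by move=> ux; exact: cvg_Complex ux (cvg_cst _). Qed.

Lemma exp_sum_cplx N x : exp_sum N (cplx x) = cplx (exp_sum N x).
Proof.
rewrite rmorph_sum; apply: eq_bigr => k _ /=.
by rewrite rmorphM fmorphV rmorphXn rmorph_nat.
Qed.

Lemma cvg_exp_sum x : (fun N => exp_sum N x) @ \oo --> expR x.
Proof.
have -> : (fun N => exp_sum N x) = series (exp_coeff x).
  by apply/funext => N; rewrite /series /= big_mkord.
exact: is_cvg_series_exp_coeff.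
Qed.

Lemma exp_sum_imu N y :
  exp_sum N (imu R * cplx y) = Complex (series (cos_coeff y) N) (series (sin_coeff y) N).
Proof.
elim: N => [|N IHN]; first by rewrite /exp_sum /series /= !big_geq // big_ord0.
rewrite /exp_sum big_ord_recr /= -/(exp_sum N _) IHN /series /= !big_nat_recr //=.
suff -> : (imu R * cplx y) ^+ N / N`!%:R = Complex (cos_coeff y N) (sin_coeff y N).
  by [].
rewrite exprMn -mulrA -{1}[N]odd_double_half -mul2n exprD exprM imu_sqr.
have -> : cplx y ^+ N / N`!%:R = cplx (y ^+ N / N`!%:R).
  by rewrite rmorphM fmorphV rmorphXn rmorph_nat.
have -> : (-1) ^+ N./2 = cplx ((-1) ^+ N./2) :> C R by rewrite rmorphXn rmorphN1.
rewrite -mulrA -rmorphM Complex_split /cos_coeff /sin_coeff /=.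
case: (boolP (odd N)) => oN /=.
  have -> : N.-1./2 = N./2 by rewrite -{1}[N]odd_double_half oN /= doubleK.
  by rewrite !mul0r rmorph0 add0r mul1r expr1 mulrA.
by rewrite !mul0r rmorph0 mulr0 addr0 !mul1r mulrA.
Qed.

Lemma cvg_exp_sum_imu y :
  (fun N => exp_sum N (imu R * cplx y)) @ \oo --> (Complex (cos y) (sin y) : C R).
Proof.
under eq_fun do rewrite exp_sum_imu.
apply: cvg_Complex; rewrite unlock.
  exact: is_cvg_series_cos_coeff.
exact: is_cvg_series_sin_coeff.
Qed.

Lemma cvg_expC z : (fun N => exp_sum N z) @ \oo --> expC z.
Proof.
case: z => x y; rewrite Complex_split; set a := cplx x; set b := imu R * cplx y.
have -> : expC (a + b) = cplx (expR x) * Complex (cos y) (sin y).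
  rewrite -Complex_split /expC /=.
  by apply/eqP; rewrite eq_complex /= !mul0r subr0 addr0 !eqxx.
have cvg_ab : (fun N => exp_sum N a * exp_sum N b) @ \oo -->
    cplx (expR x) * Complex (cos y) (sin y).
  apply: cvgM; last exact: cvg_exp_sum_imu.
  under eq_fun do rewrite exp_sum_cplx.
  exact/cvg_cplx/cvg_exp_sum.
have defect0 : (fun N => exp_sum N `|x| * exp_sum N `|y| - exp_sum N (`|x| + `|y|))
    @ \oo --> (0 : R).
  rewrite -[0](subrr (expR (`|x| + `|y|))) {1}expRD.
  by apply: cvgB; [apply: cvgM|]; exact: cvg_exp_sum.
apply/cvgrPdist_lt => e /[dup] e0 /cplx_gt0P[d d0 eE].
near=> N.
rewrite -(subrKA (exp_sum N a * exp_sum N b)).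
apply: le_lt_trans (ler_normD _ _) _; rewrite [ltRHS]splitr ltrD //.
  near: N; move/cvgrPdist_lt : cvg_ab; apply; rewrite divr_gt0 //.
apply: le_lt_trans (exp_sum_defect_le _ _ _) _.
have -> : `|a| = cplx `|x| by rewrite norm_cplx.
have -> : `|b| = cplx `|y| by rewrite normrM norm_imu mul1r norm_cplx.
rewrite -rmorphD !exp_sum_cplx -rmorphM -rmorphB.
have -> : e / 2 = cplx (d / 2) by rewrite eE rmorphM fmorphV rmorph_nat.
rewrite ltr_cplx; near: N; move/cvgrPdist_lt : defect0.
move=> /(_ (d / 2)) [|N0 _ N0P]; first by rewrite divr_gt0.
by exists N0 => // N /N0P; rewrite /= sub0r normrN; apply: le_lt_trans; exact: ler_norm.
Unshelve. all: by end_near. Qed.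
End ExpC.

(** * Functionals on polynomials determined by powers of linear forms *)

Section Polarization.
Variables (K : numFieldType) (n : nat).
Implicit Types (p q : mpoly.mpoly n K) (w b : 'I_n -> K).

Definition var i : mpoly.mpoly n K := mpoly.mpolyX K (mpoly.mnm1 i).
Definition linear_form w : mpoly.mpoly n K := \sum_(i < n) w i *: var i.

Lemma mpoly_var_ind (P : mpoly.mpoly n K -> Prop) :
  (forall c, P (c *: 1)) -> (forall p q, P p -> P q -> P (p + q)) ->
  (forall i p, P p -> P (var i * p)) -> forall p, P p.
Proof.
move=> PC PD PX; elim/mpoly.mpolyind => [|c m p _ _ Pp].
  by rewrite -(scale0r 1); apply: PC.
apply: PD Pp; rewrite mpoly.mpolyXE_id -[\prod_(i < n) _]mulr1 scalerAr.
elim/big_rec: _ => [|i q _ Pq]; first by rewrite mul1r.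
rewrite -mulrA; elim: (m i) => [|k IHk]; first by rewrite expr0 mul1r.
by rewrite exprS -mulrA; apply: PX.
Qed.

Lemma horner_inj (f g : {poly K}) : (forall x, f.[x] = g.[x]) -> f = g.
Proof.
move=> fg; apply/eqP; rewrite -subr_eq0; apply/eqP.
pose d := f - g; apply: (@roots_geq_poly_eq0 _ d [seq i%:R | i <- iota 0 (size d)]).
- by apply/allP => x _; rewrite /root hornerD hornerN fg subrr.
- by rewrite map_inj_uniq ?iota_uniq // => i j /eqP; rewrite eqr_nat => /eqP.
- by rewrite size_map size_iota.
Qed.

(** Polarization, one variable at a time: if L(l^k q) = l(b)^k q(b) holds for
    all linear forms l and all k, replace l by l + s z_i and compare the
    coefficients of s in degree 1 to get the same with q replaced by z_i q. *)
Lemma eval_of_powers (L : {linear mpoly.mpoly n K -> K}) b :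
  (forall w k, L (linear_form w ^+ k) = mpoly.meval b (linear_form w) ^+ k) ->
  forall p, L p = mpoly.meval b p.
Proof.
move=> Lpow p.
have LZ c q : L (c *: q) = c * L q by rewrite linearZ.
suff /(_ (fun=> 0) 0%N) : forall w k,
    L (linear_form w ^+ k * p) = mpoly.meval b (linear_form w) ^+ k * mpoly.meval b p.
  by rewrite !expr0 !mul1r.
elim/mpoly_var_ind: p => [c|p q Lp Lq|i p Lp] w k.
- by rewrite -scalerAr mulr1 LZ Lpow mpoly.mevalZ mpoly.meval1 mulr1 mulrC.
- by rewrite mulrDr linearD Lp Lq mpoly.mevalD mulrDr.
set l := linear_form w in Lp *.
have shift s : exists w', linear_form w' = s *: var i + l.
  exists (fun j => s * (j == i)%:R + w j).
  rewrite /linear_form; under eq_bigr do rewrite scalerDl.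
  rewrite big_split /= (bigD1 i) //= eqxx mulr1 big1 ?addr0 // => j /negPf ->.
  by rewrite mulr0 scale0r.
pose f := \poly_(j < k.+2) (L (l ^+ (k.+1 - j) * var i ^+ j * p) *+ 'C(k.+1, j)).
pose g := \poly_(j < k.+2)
  ((mpoly.meval b l ^+ (k.+1 - j) * b i ^+ j * mpoly.meval b p) *+ 'C(k.+1, j)).
have fg : f = g.
  apply: horner_inj => s; have [w' w'E] := shift s.
  have := Lp w' k.+1; rewrite w'E !horner_poly addrC exprDn.
  rewrite mulr_suml linear_sum mpoly.mevalD mpoly.mevalZ exprDn mulr_suml => LE.
  transitivity (\sum_(j < k.+2) L (l ^+ (k.+1 - j) * (s *: var i) ^+ j *+ 'C(k.+1, j) * p)).
    apply: eq_bigr => j _; rewrite [in RHS]mulrnAl raddfMn exprZn.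
    by rewrite /= -scalerAr -scalerAl LZ mulrnAl mulrC.
  rewrite LE; apply: eq_bigr => j _; rewrite mpoly.mevalXU exprMn !mulrnAl.
  by congr (_ *+ _); ring.
have /eqP : f`_1 = g`_1 by rewrite fg.
rewrite !coef_poly /= subn1 /= !expr1 bin1 eqr_pMn2r // => /eqP LE.
by rewrite mulrA LE mpoly.mevalM mpoly.mevalXU mulrA.
Qed.
End Polarization.

Lemma eval_of_var_mul (K : numFieldType) n (L : {linear mpoly.mpoly n K -> K}) b :
  L 1 = 1 -> (forall i p, L (var K i * p) = b i * L p) ->
  forall p, L p = mpoly.meval b p.
Proof.
move=> L1 Lvar; elim/mpoly_var_ind => [c|p q Lp Lq|i p Lp].
- by rewrite linearZ /= L1 mpoly.mevalZ mpoly.meval1.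
- by rewrite linearD /= Lp Lq mpoly.mevalD.
- by rewrite Lvar Lp mpoly.mevalM mpoly.mevalXU.
Qed.

(** * Bounded maps between normed spaces over the complex numbers *)

Section Bounded.
Variables (R : realType) (V W : normedModType (C R)).

(** The constant in [bounded_op] is a complex number, possibly not a
    nonnegative real; its modulus serves as well. *)
Lemma bounded_op_cplx (T : V -> W) : bounded_op T ->
  exists2 m : R, 0 <= m & forall x, `|T x| <= cplx m * `|x|.
Proof.
move=> [m mP]; exists (nrm m) => [|x]; first exact: nrm_ge0.
have mx0 : 0 <= m * `|x| by apply: le_trans (mP x).
by rewrite cplx_nrm -[`|x|]normr_id -normrM ger0_norm.
Qed.

Lemma bounded_cvg (T : V -> W) (u : nat -> V) (l : V) :
  (forall x y, T (x - y) = T x - T y) -> bounded_op T ->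
  u @ \oo --> l -> (fun N => T (u N)) @ \oo --> T l.
Proof.
move=> TB /bounded_op_cplx[m m0 mP] ul; apply/cvgrPdist_lt => e e0.
have m1 : 0 < cplx m + 1 by rewrite ltr_wpDl // cplx_ge0.
near=> N; rewrite -TB; apply: le_lt_trans (mP _) _.
apply: (@le_lt_trans _ _ ((cplx m + 1) * `|l - u N|)).
  by rewrite ler_wpM2r // lerDl.
rewrite mulrC -ltr_pdivlMr //; near: N.
by move/cvgrPdist_lt : ul; apply; rewrite divr_gt0.
Unshelve. all: by end_near. Qed.

Lemma bounded_eq_dense (S T : V -> W) (D : set V) :
  (forall x y, S (x - y) = S x - S y) -> bounded_op S ->
  (forall x y, T (x - y) = T x - T y) -> bounded_op T ->
  dense D -> (forall x, D x -> S x = T x) -> S =1 T.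
Proof.
move=> SB /bounded_op_cplx[a a0 aP] TB /bounded_op_cplx[b b0 bP] dD ST x.
apply/eqP; rewrite -subr_eq0 -normr_le0; apply/negP => /negP.
rewrite -real_ltNge ?normr_real // => d0; set d := `|_| in d0.
have ab1 : 0 < cplx a + cplx b + 1.
  by rewrite ltr_wpDl // addr_ge0 // cplx_ge0.
have [y [/= xy /ST STy]] : ball x (d / (cplx a + cplx b + 1)) `&` D !=set0.
  apply: dD; last exact: ball_open.
  by exists x; apply: ballxx; rewrite divr_gt0.
have : d <= (cplx a + cplx b) * `|x - y|.
  have -> : d = `|S (x - y) - T (x - y)|.
    by rewrite SB TB STy opprB addrA subrK.
  by apply: le_trans (ler_normB _ _) _; rewrite mulrDl lerD.
move: xy; rewrite -ball_normE /= ltr_pdivlMr // mulrDr mulr1 => xy dle.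
by have := lt_le_trans xy dle; rewrite [X in _ < X -> _]mulrC gtrDl normr_lt0.
Qed.
End Bounded.

(** * Polynomials and exponentials in the function space *)

Section Space.
Variables (R : realType) (n : nat) (E : set 'rV[C R]_n) (X : funSpace E).
Hypothesis (XQ : Q1Q2Q3 X).
Notation poly := (mpoly.mpoly n (C R)).

Definition poly_elt (p : poly) : X := elt X (poly_fun p).

Lemma fval_poly_elt p : fval X (poly_elt p) = poly_fun p.
Proof. by apply/fval_elt/poly_mem. Qed.

Lemma poly_elt_linear : linear poly_elt.
Proof.
move=> a p q; apply: fval_inj; rewrite linearP !fval_poly_elt.
by apply/funext => z; rewrite /poly_fun mpoly.mevalD mpoly.mevalZ.
Qed.
HB.instance Definition _ := GRing.isLinear.Build (C R) poly X _ poly_elt poly_elt_linear.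

Lemma poly_elt_var (i : 'I_n) : exists2 m : R, 0 <= m &
  forall p, `|poly_elt (var (C R) i * p)| <= cplx m * `|poly_elt p|.
Proof.
have [S [/bounded_op_cplx[m m0 mP] SE]] := shift_bounded XQ i.
exists m => // p; suff -> : poly_elt (var (C R) i * p) = S (poly_elt p) by [].
apply: fval_inj; rewrite fval_poly_elt; apply/funext => z.
by rewrite SE fval_poly_elt /poly_fun mpoly.mevalM mpoly.mevalXU.
Qed.

Lemma poly_elt_linear_form (w : 'I_n -> C R) : exists2 A : R, 0 <= A &
  forall k, `|poly_elt (linear_form w ^+ k)| <= cplx (A ^+ k) * `|poly_elt 1|.
Proof.
have bound i : exists m : R, 0 <= m /\
    forall p, `|poly_elt (var (C R) i * p)| <= cplx m * `|poly_elt p|.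
  by have [m m0 mP] := poly_elt_var i; exists m.
have [m mP] := fin_all_exists bound.
exists (\sum_i nrm (w i) * m i).
  by apply: sumr_ge0 => i _; rewrite mulr_ge0 ?nrm_ge0 //; case: (mP i).
elim=> [|k IHk]; first by rewrite !expr0 rmorph1 mul1r.
rewrite !exprS rmorphM -mulrA; apply: le_trans (ler_wpM2l _ IHk); last first.
  by rewrite cplx_ge0 sumr_ge0 // => i _; rewrite mulr_ge0 ?nrm_ge0 //; case: (mP i).
rewrite mulr_suml linear_sum rmorph_sum mulr_suml /=.
apply: le_trans (ler_norm_sum _ _ _) (ler_sum _ _) => i _.
rewrite -scalerAl linearZ normrZ rmorphM /= cplx_nrm -mulrA ler_wpM2l //.
by case: (mP i).
Qed.

Definition exp_poly (w : 'I_n -> C R) N : poly :=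
  \sum_(k < N) k`!%:R^-1 *: linear_form w ^+ k.

(** The exponential series of the linear form w.z converges absolutely in the
    norm of X, because multiplication by w.z is bounded there; the limit is the
    function exp(w.z) because point evaluations are continuous. *)
Lemma cvg_exp_fun (w : 'rV[C R]_n) : exists2 f : X, fval X f = exp_fun w &
  (fun N => poly_elt (exp_poly (w 0) N)) @ \oo --> f.
Proof.
have [A A0 powA] := poly_elt_linear_form (w 0).
pose u k := poly_elt (k`!%:R^-1 *: linear_form (w 0) ^+ k).
have uE : (fun N => poly_elt (exp_poly (w 0) N)) = series u.
  by apply/funext => N; rewrite linear_sum /series /= big_mkord.
have u_le k : `|u k| <= cplx (exp_coeff A k) * `|poly_elt 1|.
  rewrite /u linearZ normrZ normfV normr_nat /exp_coeff /= rmorphM fmorphV rmorph_nat.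
  by rewrite [cplx _ * _]mulrC -mulrA ler_wpM2l ?invr_ge0.
have cvg_u : cvg (series u @ \oo).
  apply: cauchy_cvg; apply/cauchy_seriesP => _ /cplx_gt0P[e e0 ->].
  have b1 : 0 < nrm `|poly_elt 1| + 1 by rewrite ltr_wpDl ?nrm_ge0.
  have /cauchy_cvgP/cauchy_seriesP/(_ (e / (nrm `|poly_elt 1| + 1))) :=
    @is_cvg_series_exp_coeff R A.
  rewrite divr_gt0 // => /(_ isT); apply: filterS => -[N N'] /=.
  rewrite ltr_pdivlMr // => lt_e.
  apply: le_lt_trans (ler_norm_sum _ _ _) _.
  apply: le_lt_trans (ler_sum _ (fun k _ => u_le k)) _.
  rewrite -mulr_suml -(rmorph_sum (@cplx R)) -[`|poly_elt 1|]normr_id -cplx_nrm.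
  rewrite -rmorphM ltr_cplx; apply: le_lt_trans lt_e.
  by rewrite ler_pM ?nrm_ge0 ?ler_norm ?lerDl // sumr_ge0 // => k _; apply: exp_coeff_ge0.
exists (lim (series u @ \oo)); last by rewrite uE.
apply/funext => z.
have eval_cvg : (fun N => fval X (series u N) z : C R) @ \oo -->
    fval X (lim (series u @ \oo)) z.
  apply: (@bounded_cvg R _ _ (fun f => fval X f z : C R)) cvg_u; last exact: eval_bounded.
  by move=> f g; rewrite linearB.
have seriesE N : fval X (series u N) z = exp_sum N (\sum_(i < n) w 0 i * val z 0 i).
  rewrite -uE fval_poly_elt /poly_fun raddf_sum; apply: eq_bigr => k _ /=.
  rewrite mpoly.mevalZ rmorphXn mulrC raddf_sum /=; congr (_ ^+ _ / _).
  by apply: eq_bigr => i _; rewrite mpoly.mevalZ mpoly.mevalXU.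
move: eval_cvg; under eq_fun do rewrite seriesE.
by move=> /cvg_unique; apply; [exact: norm_hausdorff|exact: cvg_expC].
Qed.

Lemma exp_mem (w : 'rV[C R]_n) : mem_space X (exp_fun w).
Proof. by have [f fE _] := cvg_exp_fun w; exists f. Qed.

Lemma cvg_exp_elt (w : 'rV[C R]_n) :
  (fun N => poly_elt (exp_poly (w 0) N)) @ \oo --> elt X (exp_fun w).
Proof. by have [f <-] := cvg_exp_fun w; rewrite elt_fval. Qed.

(** * From the functional to the point *)

Section Functional.
Variable L : {linear X -> C R}.
Hypotheses (L_bounded : bounded_op L) (L_one : L (poly_elt 1) = 1).

(** L itself witnesses that evaluation of polynomials at b is bounded, so b
    belongs to the domain; then L and evaluation at b are two bounded maps
    that agree on a dense set. *)
Lemma eval_of_poly_eval (b : 'I_n -> C R) :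
  (forall p, L (poly_elt p) = mpoly.meval b p) ->
  exists z : E, forall f : X, L f = fval X f z.
Proof.
move=> Lb; pose a : 'rV[C R]_n := \row_i b i.
have Lp p : L (poly_elt p) = mpoly.meval (coords a) p.
  by rewrite Lb; apply: mpoly.meval_eq => i; rewrite /coords mxE.
have Ea : E a by apply: (eval_domain XQ); exists L.
pose z : E := exist _ a (mem_set Ea); exists z.
apply: (bounded_eq_dense _ L_bounded _ (eval_bounded XQ z) (poly_dense XQ)).
- by move=> f g; rewrite linearB.
- by move=> f g; rewrite linearB.
by move=> f [p fE]; rewrite -(elt_fval f) fE -/(poly_elt p) Lp fval_poly_elt.
Qed.

(** The coefficients L((w.z)^k) / k! are those of the entire function
    t |-> L(exp(t w.z)), which has no zero and is of exponential type because L
    and multiplication by w.z are bounded. *)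
Lemma functional_powers (w : 'I_n -> C R) :
  (forall t, L (elt X (exp_fun (\row_i (t * w i)))) <> 0) ->
  forall k, L (poly_elt (linear_form w ^+ k)) = L (poly_elt (linear_form w)) ^+ k.
Proof.
move=> L_exp.
have [m m0 Lm] := bounded_op_cplx L_bounded.
have [A A0 powA] := poly_elt_linear_form w.
pose c k := L (poly_elt (linear_form w ^+ k)) / k`!%:R.
have fact0 k : k`!%:R != 0 :> C R by rewrite pnatr_eq0 -lt0n fact_gt0.
have c_le k : `|c k| <= cplx ((m * nrm `|poly_elt 1|) * (A ^+ k / k`!%:R)).
  rewrite normf_div normr_nat ler_pdivrMr ?ltr0n ?fact_gt0 //.
  apply: le_trans (Lm _) _; apply: le_trans (ler_wpM2l _ (powA k)) _.
    by rewrite cplx_ge0.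
  have normE : `|poly_elt 1| = cplx (nrm `|poly_elt 1|) by rewrite cplx_nrm normr_id.
  rewrite [X in _ * (_ * X) <= _]normE -[X in _ <= _ * X](rmorph_nat (@cplx R)).
  rewrite -!rmorphM ler_cplx le_eqVlt; apply/orP; left; apply/eqP.
  by field; rewrite pnatr_eq0 -lt0n fact_gt0.
have taylorE t N : (taylor c N).[t] = L (poly_elt (exp_poly (fun i => t * w i) N)).
  rewrite horner_poly /exp_poly !linear_sum; apply: eq_bigr => k _ /=.
  have -> : linear_form (fun i => t * w i) = t *: linear_form w.
    by rewrite /linear_form scaler_sumr; apply: eq_bigr => i _; rewrite scalerA.
  by rewrite exprZn !linearZ /= /c mulrAC mulrC [X in _ * X]mulrC.
have c0 : c 0%N = 1 by rewrite /c expr0 L_one divr1.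
have nonvanishing t : exists2 d : R, 0 < d &
    exists N0, forall N, (N0 <= N)%N -> cplx d <= `|(taylor c N).[t]|.
  set v := L (elt X (exp_fun (\row_i (t * w i)))).
  have v0 : 0 < nrm v.
    by rewrite -ltr_cplx cplx_nrm rmorph0 normr_gt0; apply/eqP/L_exp.
  have cvg_v : (fun N => (taylor c N).[t]) @ \oo --> v.
    under eq_fun do rewrite taylorE.
    have := bounded_cvg (fun x y => linearB L x y) L_bounded
      (cvg_exp_elt (w := \row_i (t * w i))).
    have -> : (\row_i (t * w i)) 0 = (fun i => t * w i) by apply/funext => i; rewrite mxE.
    by [].
  exists (nrm v / 2); first by rewrite divr_gt0.
  move/cvgrPdist_lt : cvg_v => /(_ (cplx (nrm v / 2)))[|N0 _ N0P].
    by rewrite -(rmorph0 (@cplx R)) ltr_cplx divr_gt0.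
  exists N0 => N /N0P /= lt_v.
  have : `|v| - `|v - (taylor c N).[t]| <= `|(taylor c N).[t]|.
    by rewrite lerBlDr addrC (le_trans _ (ler_normD _ _)) // subrK.
  apply: le_trans; rewrite lerBrDr -(cplx_nrm v) [X in _ <= cplx X]splitr rmorphD /= lerD2l.
  exact: ltW.
have geometric k := coef_geometric c0 (mulr_ge0 m0 (nrm_ge0 _)) A0 c_le nonvanishing k.
elim=> [|k IHk]; first by rewrite !expr0.
move: (geometric k); rewrite /c expr1 divr1 => gk; rewrite [RHS]exprS -IHk.
have : L (poly_elt (linear_form w ^+ k.+1)) / k`!%:R =
       L (poly_elt (linear_form w)) * L (poly_elt (linear_form w ^+ k)) / k`!%:R.
  by rewrite -mulrA -gk factS natrM -[RHS]mulr_natr invfM mulrA mulrAC mulfVK ?pnatr_eq0.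
by move/(mulIf (invr_neq0 (fact0 k))).
Qed.
Lemma point_of_nonvanishing :
  (forall w, L (elt X (exp_fun w)) <> 0) ->
  exists z : E, forall f : X, L f = fval X f z.
Proof.
move=> L_exp; pose b i := L (poly_elt (var (C R) i)).
apply: (@eval_of_poly_eval b).
apply: (@eval_of_powers _ _ (L \o poly_elt)) => w k /=.
rewrite functional_powers; last by move=> t; apply: L_exp.
congr (_ ^+ _); rewrite /linear_form !raddf_sum; apply: eq_bigr => i _ /=.
by rewrite !linearZ /= mpoly.mevalXU.
Qed.

Lemma point_of_multiplicative :
  (forall phi, multiplier X phi ->
    forall f : X, L (elt X (phi \* fval X f)) = L (elt X phi) * L f) ->
  exists z : E, forall f : X, L f = fval X f z.
Proof.
move=> L_mul; pose b i := L (poly_elt (var (C R) i)).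
apply: (@eval_of_poly_eval b).
apply: (@eval_of_var_mul _ _ (L \o poly_elt)) => // i p /=.
have coord_mult : multiplier X (poly_fun (var (C R) i)).
  move=> f; have [S [_ SE]] := shift_bounded XQ i; exists (S f).
  by apply/funext => z; rewrite SE /= /poly_fun mpoly.mevalXU.
rewrite -L_mul //; congr (L (elt X _)).
by apply/funext => z; rewrite /= fval_poly_elt /poly_fun mpoly.mevalM.
Qed.
End Functional.
End Space.

Lemma expC_neq0 (R : realType) (z : C R) : expC z <> 0.
Proof.
case: z => x y [] /eqP + /eqP.
rewrite !mulf_eq0 !(gt_eqF (expR_gt0 x)) /= => /eqP c0 /eqP s0.
by have /eqP := cos2Dsin2 y; rewrite c0 s0 !expr0n /= addr0 eq_sym oner_eq0.
Qed.

Theorem theorem5p3 (R : realType) (n : nat) (Dhat D : set 'rV[C R]_n)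
  (X : funSpace Dhat) (D_open : open D) (D_sub : D `<=` Dhat)
  (X_analytic : forall (f : X) (a : 'rV[C R]_n), D a -> analytic_at (fval X f) a)
  (X_Q : Q1Q2Q3 X)
  (L : {linear X -> C R}) (L_bounded : bounded_op L)
  (L_one : L (elt X (fun=> 1)) = 1) :
  [<-> (* i *)
       forall w : 'rV[C R]_n, L (elt X (exp_fun w)) <> 0;
       (* ii *)
       exists b : Dhat, forall f : X, L f = fval X f b;
       (* iii *)
       forall f g : X, mem_space X (fval X f \* fval X g) ->
         L (elt X (fval X f \* fval X g)) = L f * L g;
       (* iv *)
       forall phi : Dhat -> C R, multiplier X phi ->
         forall f : X, L (elt X (phi \* fval X f)) = L (elt X phi) * L f].
Proof.
have L_poly1 : L (poly_elt X 1) = 1.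
  rewrite -L_one; congr (L (elt X _)).
  by apply/funext => z; rewrite /poly_fun mpoly.meval1.
tfae.
- exact: point_of_nonvanishing.
- move=> [b Lb] f g fg; rewrite !Lb fval_elt //.
- move=> L_mul phi phi_mult f.
  have phiE := fval_elt (multiplier_mem X_Q phi_mult).
  by rewrite -{1}phiE L_mul // phiE; apply: phi_mult.
- move=> L_mul w; have [b Lb] := point_of_multiplicative X_Q L_bounded L_poly1 L_mul.
  by rewrite Lb fval_elt; [exact: expC_neq0|exact: exp_mem].
Qed.
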